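(* Let $\hat A$ be an $m\times n$ totally unimodular matrix, let $a^{\mathsf{T}}$ be a row of $\hat A$ (with $a\in\mathbb{Z}^n$ a column vector), let $b,c\in\mathbb{Z}^m$, and define $A:=\hat A+c\,a^{\mathsf{T}}$. Let $P_{A,b}$ be the convex hull of $\{x\in\mathbb{Z}^n : Ax\le b\}$. Then $P_{A,b}$ has the Integer Carathéodory Property.
   Context: A matrix is totally unimodular if every square submatrix has determinant in $\{-1,0,1\}$. Inequalities between vectors are componentwise, and for a set $P\subseteq\mathbb{R}^n$ and a positive integer $k$, $kP=\{kx:x\in P\}$. A polyhedron $P\subseteq\mathbb{R}^n$ has the Integer Carathéodory Property (ICP) if for every positive integer $k$ and every integer vector $w\in kP$ there exist affinely independent $x_1,\ldots,x_t\in P\cap\mathbb{Z}^n$ and $n_1,\ldots,n_t\in\mathbb{Z}_{\ge 0}$ such that $n_1+\cdots+n_t=k$ and $w=\sum_{i} n_i x_i$. *)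

(* Defs.v *)
From mathcomp Require Import all_boot all_order all_algebra.
From mathcomp Require Import boolp classical_sets reals convex.

Set Implicit Arguments.
Unset Strict Implicit.
Unset Printing Implicit Defensive.

Import Order.TTheory GRing.Theory Num.Theory.
Local Open Scope classical_set_scope.
Local Open Scope ring_scope.

(* The maps [f] and [g] list, in increasing order, the rows and columns of a  *)
(* k x k submatrix.                                                           *)
Definition totally_unimodular (R : comNzRingType) (m n : nat)
    (A : 'M[R]_(m, n)) : Prop :=
  forall (k : nat) (f : 'I_k -> 'I_m) (g : 'I_k -> 'I_n),
    {homo f : i j / (i < j)%N} -> {homo g : i j / (i < j)%N} ->
    \det (mxsub f g A) \in [:: -1; 0; 1].

Definition integer_points (R : realType) (n : nat) : set 'cV[R]_n :=
  [set x | x \is a mxOver Num.int].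
Arguments integer_points : clear implicits.

Definition convex_hull (R : realType) (n : nat) (X : set 'cV[R]_n) :
    set 'cV[R]_n :=
  smallest (@convex_set R 'cV[R]_n) X.

Definition affinely_independent (R : realType) (n t : nat)
    (x : 'I_t -> 'cV[R]_n) : Prop :=
  forall l : 'I_t -> R,
    \sum_i l i = 0 -> \sum_i l i *: x i = 0 -> forall i, l i = 0.

Definition integer_Caratheodory_property (R : realType) (n : nat)
    (P : set 'cV[R]_n) : Prop :=
  forall (k : nat) (w : 'cV[R]_n),
    (0 < k)%N -> integer_points R n w -> [set k%:R *: x | x in P] w ->
    exists (t : nat) (x : 'I_t -> 'cV[R]_n) (c : 'I_t -> nat),
      [/\ affinely_independent x,
          forall i, (P `&` integer_points R n) (x i),
          (\sum_i c i)%N = k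
        & w = \sum_i (c i)%:R *: x i].

Definition integer_hull (R : realType) (m n : nat)
    (A : 'M[int]_(m, n)) (b : 'cV[int]_m) : set 'cV[R]_n :=
  convex_hull [set x | integer_points R n x /\
    forall i, (map_mx intr A *m x) i 0 <= (b i 0)%:~R].
Arguments integer_hull R {m n} A b.

(* Main.v *)
(* Idea.  Adding the rows of the identity to Ahat keeps it totally unimodular,
   say M, and makes M injective.  Let a.w = k q + k2 with 0 <= k2 < k, and
   k1 = k - k2.  A point of the hull is a convex combination of a point with
   a.x <= q and one with a.x >= q + 1; the segment between them crosses the
   levels a.x = q and a.x = q + 1 inside {A x <= b}.  Hence w = y1 + y2, where
   y1 / k1 and y2 / k2 satisfy A x <= b on these two levels.  There the system
   A x <= b reads Ahat x <= b - q c (resp. b - (q + 1) c), so its right-hand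
   side is integral and M may replace A.

   Enclose y1 / k1 and y2 / k2 in cells {floor <= M x <= ceil} C1 and C2.  The
   polytope k1 C1 :&: (w - k2 C2) has an integral vertex z1; put z2 = w - z1.
   The rows of M that are tight at z1 or at z2 have trivial common kernel, so
   affinely independent points in the cell of z1 / k1 and in the cell of
   z2 / k2 have an affinely independent union.

   In one cell, take an integral point x and subtract the largest multiple
   lambda x that keeps z - lambda x in (k - lambda) times the cell.  As each
   row takes only two consecutive values on the cell, lambda is an integer, and
   the rest lies on a face that misses x: induct on the dimension of the face. *)
Require Import Defs.
From mathcomp Require Import all_boot all_order all_fingroup all_algebra.
From mathcomp Require Import boolp classical_sets reals interval_inference convex.
From mathcomp Require Import zify ring lra.
Import Order.TTheory GRing.Theory Num.Theory.
Local Open Scope ring_scope.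

(** * Total unimodularity: arbitrary row selections and adjoined unit rows *)

Lemma perm_increasing {k m : nat} (f : 'I_k -> 'I_m) :
  injective f ->
  exists s : 'S_k, {homo (fun i => f (s i)) : i j / (i < j)%N}.
Proof.
move=> f_inj; pose le_m := [rel x y : 'I_m | (x <= y)%N].
have le_total : total le_m by move=> x y; exact: leq_total.
have le_trans : transitive le_m by move=> y x z; exact: leq_trans.
pose t := [tuple f i | i < k].
have /tuple_permP[s s_eq] : perm_eq (sort le_m t) t by rewrite perm_sort.
exists s => i j lt_ij.
have nthE (l : 'I_k) : nth (f l) (sort le_m t) l = f (s l).
  by rewrite s_eq (nth_map l) ?size_enum_ord // nth_ord_enum tnth_mktuple.
have size_t : size (sort le_m t) = k by rewrite size_sort size_tuple.
have: le_m (f (s i)) (f (s j)).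
  rewrite -!nthE (set_nth_default (f i) (f j)) ?size_t //.
  have le_refl : reflexive le_m by move=> x; exact: leqnn.
  have := sorted_leq_nth le_trans le_refl (f i) (sort_sorted le_total t).
  by move=> /(_ i j); rewrite !inE size_t !ltn_ord; apply => //; exact: ltnW.
rewrite /= leq_eqVlt => /orP[/eqP/val_inj/f_inj/perm_inj eq_ij|//].
by rewrite eq_ij ltnn in lt_ij.
Qed.

Lemma mulr_sign_unimodular {R : comNzRingType} (e : nat) (x : R) :
  x \in [:: -1; 0; 1] -> (-1) ^+ e * x \in [:: -1; 0; 1].
Proof.
rewrite -signr_odd; case: odd; rewrite ?mul1r // expr1 mulN1r !inE.
by move=> /or3P[] /eqP ->; rewrite ?opprK ?oppr0 eqxx ?orbT.
Qed.

(** The definition covers increasing selections only. A repeated row makes the determinant vanish;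
    otherwise sorting the rows changes at most its sign. *)
Lemma totally_unimodular_rowsub {R : comNzRingType} {m n : nat}
    (A : 'M[R]_(m, n)) (f : 'I_n -> 'I_m) :
  totally_unimodular A -> \det (rowsub f A) \in [:: -1; 0; 1].
Proof.
move=> tuA; have [/injectiveP f_inj|/injectivePn[i [j ne_ij eq_f]]] :=
  boolP (injectiveb f); last first.
  rewrite (determinant_alternate ne_ij) ?inE ?eqxx ?orbT // => l.
  by rewrite !mxE eq_f.
have [s s_mono] := perm_increasing _ f_inj.
have := tuA _ _ id s_mono (fun _ _ h => h).
have -> : rowsub (fun i => f (s i)) A = row_perm s (rowsub f A).
  by apply/matrixP => i j; rewrite !mxE.
by rewrite row_permE det_mulmx det_perm => /(mulr_sign_unimodular s); rewrite signrMK.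
Qed.

(** Induction on the size of the minor. A row coming from the identity is either zero or has a
    single entry 1, and expanding along it leaves, up to sign, a smaller minor. *)
Lemma totally_unimodular_col_mx1 {R : comNzRingType} {m n : nat}
    (A : 'M[R]_(m, n)) :
  totally_unimodular A -> totally_unimodular (col_mx A 1%:M).
Proof.
move=> tuA; elim=> [|k IHk] f g f_mono g_mono.
  by rewrite det_mx00 !inE eqxx !orbT.
have lift_mono (i : 'I_k.+1) :
    {homo lift i : a b / (a < b)%N >-> (a < b)%N}.
  by move=> a b; rewrite /= /bump; lia.
have [f_left|] := pselect (forall i, exists j, f i = lshift n j).
  have [f' fE] := fin_all_exists f_left.
  have -> : mxsub f g (col_mx A 1%:M) = mxsub f' g A.
    by apply/matrixP => i j; rewrite mxE fE col_mxEu [RHS]mxE.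
  by apply: tuA => // i j /f_mono; rewrite !fE.
move=> /existsNP[i0 f_right].
have [l fi0] : exists l, f i0 = rshift m l.
  case: (split_ordP (f i0)) => l fE; last by exists l.
  by case: f_right; exists l.
rewrite (expand_det_row _ i0).
have rowE j : mxsub f g (col_mx A 1%:M) i0 j = (l == g j)%:R.
  by rewrite mxE fi0 col_mxEd mxE.
have [j0 gj0|no_j] := pickP (fun j => g j == l); last first.
  rewrite big1 ?inE ?eqxx ?orbT // => j _.
  by rewrite rowE eq_sym no_j mul0r.
have g_inj j : g j = l -> j = j0.
  rewrite -(eqP gj0) => eq_g; apply: val_inj => /=.
  by case: (ltngtP j j0) => // /g_mono; rewrite eq_g ltnn.
rewrite (bigD1 j0) //= big1 => [|j ne_j]; last first.
  rewrite rowE; case: eqP => [/esym/g_inj eq_j|]; last by rewrite mul0r.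
  by rewrite eq_j eqxx in ne_j.
rewrite rowE (eqP gj0) eqxx mul1r addr0 /cofactor.
have -> : row' i0 (col' j0 (mxsub f g (col_mx A 1%:M))) =
    mxsub (fun i => f (lift i0 i)) (fun j => g (lift j0 j)) (col_mx A 1%:M).
  by apply/matrixP => i j; rewrite !mxE.
apply: mulr_sign_unimodular; apply: IHk => i j lt_ij.
  by apply: f_mono; exact: lift_mono.
by apply: g_mono; exact: lift_mono.
Qed.

(** * Integral vertices of systems of interval constraints *)

(** Induction on the number of slack rows. If some nonzero [v] is killed by all tight rows, move
    along [v] until another row becomes tight; the rows already tight stay so. Some row does move
    because [M] is injective. *)
Lemma interval_system_vertex {R : realFieldType} {m n : nat}
    (M : 'M[R]_(m, n)) (l u : 'cV[R]_m) (y : 'cV[R]_n) :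
  (forall v : 'cV_n, M *m v = 0 -> v = 0) ->
  (forall r, l r 0 <= (M *m y) r 0 <= u r 0) ->
  exists2 x : 'cV[R]_n, forall r, l r 0 <= (M *m x) r 0 <= u r 0 &
    forall v : 'cV_n,
      (forall r, (M *m x) r 0 \in [:: l r 0; u r 0] -> (M *m v) r 0 = 0) ->
      v = 0.
Proof.
move=> M_inj.
pose tight (x : 'cV[R]_n) r := (M *m x) r 0 \in [:: l r 0; u r 0].
pose slack x := [set r | ~~ tight x r].
have [k] := ubnP #|slack y|; elim: k y => // k IHk y /ltnSE le_k y_in.
have [y_vertex|] := pselect
    (forall v : 'cV_n, (forall r, tight y r -> (M *m v) r 0 = 0) -> v = 0).
  by exists y.
move=> /existsNP[v /not_implyP[Tv v_neq0]].
pose moving := [pred r | (M *m v) r 0 != 0].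
have [r0 r0_moving] : exists r, moving r.
  apply/existsP; apply: contra_notT v_neq0; rewrite negb_exists => /forallP Mv0.
  apply: M_inj; apply/colP => r; rewrite [RHS]mxE.
  by apply/eqP; have := Mv0 r; rewrite negbK.
(* The time at which row [r], moving along [v], reaches the bound ahead of it. The first such time
   keeps every row within its bounds. *)
pose step r :=
  ((if 0 < (M *m v) r 0 then u r 0 else l r 0) - (M *m y) r 0) / (M *m v) r 0.
have [r1 r1_moving step_min] := arg_minP step r0_moving.
have ME r : (M *m (y + step r1 *: v)) r 0 =
    (M *m y) r 0 + step r1 * (M *m v) r 0.
  by rewrite mulmxDr -scalemxAr !mxE.
have step_ge0 r : moving r -> 0 <= step r.
  rewrite /moving /= /step => v_neq.
  have /andP[l_le le_u] := y_in r; case: ltP => [v_gt0|v_le0].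
    by rewrite divr_ge0 ?subr_ge0 // ltW.
  by rewrite -mulrNN -invrN mulr_ge0 ?invr_ge0 ?oppr_ge0 ?subr_le0.
have step1_ge0 := step_ge0 _ r1_moving.
apply: (IHk (y + step r1 *: v)) => [|r]; last first.
  have /andP[l_le le_u] := y_in r; rewrite ME.
  have [->|v_neq] := eqVneq ((M *m v) r 0) 0.
    by rewrite mulr0 addr0 l_le.
  have := step_min r v_neq; rewrite {2}/step; case: ltP => [v_gt0|v_le0].
    rewrite ler_pdivlMr // => le_step; apply/andP; split; last by lra.
    by rewrite (le_trans l_le) // lerDl mulr_ge0 // ltW.
  have v_lt0 : (M *m v) r 0 < 0 by rewrite lt_neqAle v_neq.
  rewrite ler_ndivlMr // => le_step; apply/andP; split; first by lra.
  by rewrite (le_trans _ le_u) // gerDl mulr_ge0_le0.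
apply: leq_trans le_k; apply/proper_card/properP; split.
  apply/fintype.subsetP => r; rewrite !inE; apply: contra => y_tight.
  by rewrite /tight ME Tv // mulr0 addr0.
exists r1; rewrite inE.
  by apply: contra r1_moving => y_tight; rewrite Tv.
rewrite negbK /tight ME /step mulfVK // addrC subrK !inE.
by case: ltP; rewrite eqxx ?orbT.
Qed.

(** The tight rows have full column rank, so some of them form a nonsingular square submatrix [N].
    Its determinant is 1 or -1, so [x] solves an integral system whose matrix has an integral
    inverse. *)
Lemma totally_unimodular_vertex_int {R : realFieldType} {m n : nat}
    (M : 'M[int]_(m, n)) (l u : 'cV[int]_m) (x : 'cV[R]_n) :
  totally_unimodular M ->
  (forall v : 'cV[R]_n,
    (forall r, (map_mx intr M *m x) r 0 \in [:: (l r 0)%:~R; (u r 0)%:~R] ->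
      (map_mx intr M *m v) r 0 = 0) -> v = 0) ->
  exists z : 'cV[int]_n, x = map_mx intr z.
Proof.
move=> tuM x_vertex; pose MR := map_mx (intr : int -> R) M.
pose tight r := (MR *m x) r 0 \in [:: (l r 0)%:~R; (u r 0)%:~R].
(* Slack rows are zeroed rather than removed, so the row indices remain those of [M]; an invertible
   selection of rows cannot contain a zero row. *)
pose B : 'M[R]_(m, n) := \matrix_(r, j) (if tight r then MR r j else 0).
have rowB (r : 'I_m) (v : 'cV[R]_n) :
    (B *m v) r 0 = if tight r then (MR *m v) r 0 else 0.
  rewrite !mxE; case: ifP => Tr; last rewrite big1 // => j _.
    by apply: eq_bigr => j _; rewrite [B _ _]mxE Tr.
  by rewrite mxE Tr mul0r.
have B_full : row_full B.
  rewrite -cokermx_eq0; apply/eqP/matrixP => i j; rewrite mxE.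
  suff /colP/(_ i) : col j (cokermx B) = 0 by rewrite !mxE.
  apply: x_vertex => r r_tight.
  have := rowB r (col j (cokermx B)); rewrite /tight r_tight => <-.
  by rewrite colE mulmxA mulmx_coker mul0mx mxE.
pose f := fullrankfun B_full.
have f_tight i : tight (f i).
  apply: contraT => /negbTE f_slack.
  have /matrixP/(_ i i)/eqP := mulmxV (fullrowsub_unit B_full).
  rewrite mxE big1 => [|j _]; last by rewrite 2!mxE f_slack mul0r.
  by rewrite mxE eqxx eq_sym oner_eq0.
pose N := rowsub f M.
have NE : rowsub f B = map_mx intr N.
  by apply/matrixP => i j; rewrite !mxE f_tight.
have N_unit : N \in unitmx.
  have := fullrowsub_unit B_full; rewrite -/f NE unitmxE det_map_mx unitfE intr_eq0.
  have := totally_unimodular_rowsub _ f tuM; rewrite -/N unitmxE !inE.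
  by move=> /or3P[] /eqP->; rewrite ?eqxx.
pose d := \col_i (if (MR *m x) (f i) 0 == (l (f i) 0)%:~R then l (f i) 0 else u (f i) 0).
have Nx : map_mx intr N *m x = map_mx intr d.
  apply/colP => i; rewrite map_mxsub mul_rowsub_mx [LHS]mxE [RHS]mxE.
  rewrite [d _ _]mxE -/MR.
  by have := f_tight i; rewrite /tight !inE; case: eqP => //= _ /eqP.
exists (invmx N *m d); rewrite map_mxM -Nx mulmxA -map_mxM mulVmx //.
by rewrite map_mx1 mul1mx.
Qed.

Lemma mulmx_intr {R : realFieldType} {m n : nat} (M : 'M[int]_(m, n))
    (x : 'cV[int]_n) (r : 'I_m) :
  (map_mx (intr : int -> R) M *m map_mx intr x) r 0 = ((M *m x) r 0)%:~R.
Proof. by rewrite -map_mxM mxE. Qed.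

Lemma totally_unimodular_int_vertex {R : realFieldType} {m n : nat}
    (M : 'M[int]_(m, n)) (lo hi : 'I_m -> int) (y : 'cV[R]_n) :
  totally_unimodular M ->
  (forall v : 'cV[R]_n, map_mx intr M *m v = 0 -> v = 0) ->
  (forall r, (lo r)%:~R <= (map_mx (intr : int -> R) M *m y) r 0 <= (hi r)%:~R) ->
  exists2 x : 'cV[int]_n, forall r, lo r <= (M *m x) r 0 <= hi r &
    forall v : 'cV[R]_n,
      (forall r, (M *m x) r 0 \in [:: lo r; hi r] ->
        (map_mx (intr : int -> R) M *m v) r 0 = 0) -> v = 0.
Proof.
move=> tuM M_inj y_in; pose l := \col_r lo r; pose u := \col_r hi r.
have lE r : (map_mx (intr : int -> R) l) r 0 = (lo r)%:~R by rewrite !mxE.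
have uE r : (map_mx (intr : int -> R) u) r 0 = (hi r)%:~R by rewrite !mxE.
have [|x x_in x_vertex] := interval_system_vertex (map_mx (intr : int -> R) M)
    (map_mx (intr : int -> R) l) (map_mx (intr : int -> R) u) y M_inj.
  by move=> r; rewrite lE uE.
have [|z xE] := totally_unimodular_vertex_int M l u x tuM.
  move=> v v_tight; apply: x_vertex => r; rewrite lE uE => r_tight.
  by apply: v_tight; rewrite 2![fun_of_matrix (\col_r _) _ _]mxE.
exists z => [r|v v_tight].
  by have := x_in r; rewrite xE mulmx_intr lE uE !ler_int.
apply: x_vertex => r; rewrite xE mulmx_intr lE uE !inE !eqr_int => r_tight.
by apply: v_tight; rewrite !inE.
Qed.

(** * Affinely independent decompositions and their unions *)

Definition cat_family {T : Type} {s t : nat} (x : 'I_s -> T) (y : 'I_t -> T)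
    (i : 'I_(s + t)) : T :=
  match split i with inl j => x j | inr j => y j end.

Lemma cat_family_lshift {T : Type} {s t : nat} (x : 'I_s -> T) (y : 'I_t -> T) i :
  cat_family x y (lshift t i) = x i.
Proof. by rewrite /cat_family (unsplitK (inl i)). Qed.

Lemma cat_family_rshift {T : Type} {s t : nat} (x : 'I_s -> T) (y : 'I_t -> T) i :
  cat_family x y (rshift s i) = y i.
Proof. by rewrite /cat_family (unsplitK (inr i)). Qed.

Definition affine_decomposition (R : realType) {n : nat} (Q : 'cV[int]_n -> Prop)
    (k : nat) (z : 'cV[int]_n) : Prop :=
  exists (t : nat) (x : 'I_t -> 'cV[int]_n) (c : 'I_t -> nat),
    [/\ affinely_independent (fun i => map_mx (intr : int -> R) (x i)),
        forall i, Q (x i),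
        (\sum_i c i)%N = k
      & z = \sum_i (c i)%:R *: x i].

Lemma affine_decomposition_sub {R : realType} {n : nat}
    {Q Q' : 'cV[int]_n -> Prop} {k : nat} {z : 'cV[int]_n} :
  (forall x, Q x -> Q' x) ->
  affine_decomposition R Q k z -> affine_decomposition R Q' k z.
Proof.
by move=> QQ' [t [x [c [? Qx ? ?]]]]; exists t, x, c; split=> // i; apply/QQ'/Qx.
Qed.

(** The hypothesis says that every affine dependence of the joint family restricts to one of the
    first family; by subtraction it then restricts to the second as well. *)
Lemma affine_decomposition_cat {R : realType} {n : nat}
    (Q1 Q2 : 'cV[int]_n -> Prop) (k1 k2 : nat) (z1 z2 : 'cV[int]_n) :
  (forall (s t : nat) (x : 'I_s -> 'cV[int]_n) (y : 'I_t -> 'cV[int]_n)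
      (l : 'I_s -> R) (l' : 'I_t -> R),
    (forall i, Q1 (x i)) -> (forall i, Q2 (y i)) ->
    \sum_i l i + \sum_i l' i = 0 ->
    \sum_i l i *: map_mx intr (x i) + \sum_i l' i *: map_mx intr (y i) = 0 ->
    \sum_i l i = 0 /\ \sum_i l i *: map_mx intr (x i) = 0) ->
  affine_decomposition R Q1 k1 z1 -> affine_decomposition R Q2 k2 z2 ->
  affine_decomposition R (fun x => Q1 x \/ Q2 x) (k1 + k2)%N (z1 + z2).
Proof.
move=> sep [s [x [c [x_ind Q1x <- ->]]]] [t [y [c' [y_ind Q2y <- ->]]]].
exists (s + t)%N, (cat_family x y), (cat_family c c'); split=> [l|i||].
- rewrite !big_split_ord /=.
  under [X in _ -> X + _ = _ -> _]eq_bigr do rewrite cat_family_lshift.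
  under [X in _ -> _ + X = _ -> _]eq_bigr do rewrite cat_family_rshift.
  move=> sum0 comb0; have [suml comb1] := sep _ _ _ _ _ _ Q1x Q2y sum0 comb0.
  rewrite suml add0r in sum0; rewrite comb1 add0r in comb0.
  have l_left := x_ind _ suml comb1; have l_right := y_ind _ sum0 comb0.
  by move=> i; case: (split_ordP i) => j ->; [exact: l_left|exact: l_right].
- by rewrite /cat_family; case: split => j; [left|right].
- rewrite big_split_ord /=; congr (_ + _)%N; apply: eq_bigr => i _.
    by rewrite cat_family_lshift.
  by rewrite cat_family_rshift.
- rewrite big_split_ord /=; congr (_ + _); apply: eq_bigr => i _.
    by rewrite !cat_family_lshift.
  by rewrite !cat_family_rshift.
Qed.

Lemma mulmx_level {R : realType} {m n t : nat} (M : 'M[int]_(m, n)) (r : 'I_m)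
    (x : 'I_t -> 'cV[int]_n) (l : 'I_t -> R) (d : int) :
  (forall i, (M *m x i) r 0 = d) ->
  (map_mx intr M *m \sum_i l i *: map_mx intr (x i)) r 0 = (\sum_i l i) * d%:~R.
Proof.
move=> Mx; rewrite mulmx_sumr summxE mulr_suml; apply: eq_bigr => i _.
by rewrite -scalemxAr mxE mulmx_intr Mx.
Qed.

(** Row [r] turns the dependence into [(\sum_i l i) * (d - d') = 0]. *)
Lemma sum_eq0_of_levels {R : realType} {m n s t : nat} (M : 'M[int]_(m, n))
    (r : 'I_m) (x : 'I_s -> 'cV[int]_n) (y : 'I_t -> 'cV[int]_n)
    (l : 'I_s -> R) (l' : 'I_t -> R) (d d' : int) :
  (forall i, (M *m x i) r 0 = d) -> (forall i, (M *m y i) r 0 = d') -> d != d' ->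
  \sum_i l i + \sum_i l' i = 0 ->
  \sum_i l i *: map_mx intr (x i) + \sum_i l' i *: map_mx intr (y i) = 0 ->
  \sum_i l i = 0.
Proof.
move=> Mx My ne_d /eqP; rewrite addrC addr_eq0 => /eqP suml'.
move=> /(congr1 (fun v => (map_mx intr M *m v) r 0)).
rewrite mulmxDr mxE (mulmx_level _ _ _ _ _ Mx) (mulmx_level _ _ _ _ _ My).
rewrite suml' mulNr -mulrBr mulmx0 mxE -intrB => /eqP.
by rewrite mulf_eq0 intr_eq0 subr_eq0 (negbTE ne_d) orbF => /eqP.
Qed.

Lemma affine_decomposition1 {R : realType} {n : nat} (k : nat) (x : 'cV[int]_n) :
  affine_decomposition R (eq x) k (k%:R *: x).
Proof.
exists 1%N, (fun=> x), (fun=> k); split=> //; rewrite ?big_ord1 //.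
by move=> l; rewrite !big_ord1 => l0 _ i; rewrite ord1.
Qed.

(** * Decomposition inside one cell *)

(** [S] holds the rows on which the cell has width one, and the induction is on its size. The row
    that stops the subtraction of [x] leaves [S], and its level separates [x] from all points used
    for the remainder. *)
Lemma cell_decomposition {R : realType} {m n : nat} (M : 'M[int]_(m, n))
    (k : nat) (z : 'cV[int]_n) (l : 'I_m -> int) (S : {set 'I_m}) :
  totally_unimodular M ->
  (forall v : 'cV[R]_n, map_mx intr M *m v = 0 -> v = 0) ->
  (forall r, k%:Z * l r <= (M *m z) r 0 <= k%:Z * (l r + (r \in S)%:Z)) ->
  affine_decomposition R
    (fun x => forall r, l r <= (M *m x) r 0 <= l r + (r \in S)%:Z) k z.
Proof.
move=> tuM M_inj; have [s] := ubnP #|S|.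
have int_inj (v : 'cV[int]_n) : M *m v = 0 -> v = 0.
  move=> Mv; have /colP v0 : map_mx intr v = 0 :> 'cV[R]_n.
    by apply: M_inj; rewrite -map_mxM Mv map_mx0.
  by apply/colP => j; have /eqP := v0 j; rewrite !mxE intr_eq0 => /eqP.
elim: s k z l S => // s IHs k z l S /ltnSE card_S z_in.
have [k0|k_gt0] := posnP k.
  have -> : z = 0.
    apply: int_inj; apply/colP => r; rewrite [RHS]mxE.
    by have := z_in r; rewrite k0; lia.
  exists 0%N, (fun=> 0), (fun=> 0%N).
  by split=> [c _ _ []|[]||] //; rewrite big_ord0.
have kR_gt0 : 0 < k%:R :> R by rewrite ltr0n.
have [r|x x_in _] := totally_unimodular_int_vertex M l (fun r => l r + (r \in S)%:Z)
    ((k%:R : R)^-1 *: map_mx intr z) tuM M_inj.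
  rewrite -scalemxAr mxE mulmx_intr ler_pdivlMl // ler_pdivrMl //.
  have /andP[] := z_in r.
  by rewrite -!(ler_int R) !intrM => -> ->.
have subE (e : nat) r :
    (M *m (z - e%:R *: x)) r 0 = (M *m z) r 0 - e%:Z * (M *m x) r 0.
  by rewrite mulmxBr -scalemxAr !mxE natz.
(* With [S] empty every row is constant on the cell, which is then the single point [x]. *)
have [r0 r0S|S0] := pickP (mem S); last first.
  have -> : z = k%:R *: x.
    apply/eqP; rewrite -subr_eq0; apply/eqP/int_inj/colP => r.
    rewrite subE [RHS]mxE.
    have := z_in r; have := x_in r; rewrite [r \in S]S0 addr0 => x_r.
    have -> : (M *m x) r 0 = l r by lia.
    by lia.
  apply: affine_decomposition_sub (affine_decomposition1 k x) => _ <- //.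
pose at_lo r := (M *m x) r 0%R == l r :> int.
have at_hi r : r \in S -> ~~ at_lo r -> (M *m x) r 0 = l r + 1.
  move=> rS; have := x_in r; rewrite /at_lo rS.
  by move: ((M *m x) r 0%R : int) => d; lia.
(* The largest multiple of x that row r allows to be subtracted from z. *)
pose room r := if at_lo r then k%:Z * (l r + 1) - (M *m z) r 0
               else (M *m z) r 0 - k%:Z * l r.
have [r1 /= r1S room_min] := arg_minP room r0S.
have room_bounds r : r \in S -> 0 <= room r <= k%:Z.
  by move=> rS; have := z_in r; rewrite rS /room; case: ifP => _; lia.
have [e room1] : exists e : nat, room r1 = e.
  by have := room_bounds _ r1S; case: (room r1) => // e _; exists e.
have le_ek : (e <= k)%N by have := room_bounds _ r1S; rewrite room1; lia.
(* After subtracting [e] copies of [x], row [r1] equals [k - e] times the bound that [x] does not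
   attain; [l'] fixes the row at that bound. *)
pose l' r := if (r == r1) && at_lo r then l r + 1 else l r.
have z_split : z = e%:R *: x + (z - e%:R *: x) by rewrite addrC subrK.
rewrite z_split -(subnKC le_ek).
have dec : affine_decomposition R
    (fun y => forall r, l' r <= (M *m y) r 0 <= l' r + (r \in S :\ r1)%:Z)
    (k - e) (z - e%:R *: x).
  apply: IHs; first by rewrite (cardsD1 r1) r1S in card_S.
  move=> r; rewrite subE -subzn // /l' !inE.
  have := z_in r; case: (eqVneq r r1) => [->|ne_r] /=.
    move: room1; rewrite /room r1S /=; case: ifPn => [/eqP ->|/(at_hi _ r1S) ->]; lia.
  have [rS|rS] := boolP (r \in S); last first.
    have -> : (M *m x) r 0 = l r by have := x_in r; rewrite (negbTE rS); lia.
    by lia.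
  have := room_min r rS; rewrite room1 /room /=.
  case: (ifPn (at_lo r)) => [/eqP ->|/(at_hi _ rS) ->]; lia.
apply: affine_decomposition_sub; last first.
  apply: affine_decomposition_cat (affine_decomposition1 e x) dec.
  move=> p t x' y c c' x'E y_in sumc combc.
  have Mx' i : (M *m x' i) r1 0 = (M *m x) r1 0 by rewrite -x'E.
  have My i : (M *m y i) r1 0 = l' r1 by have := y_in i r1; rewrite !inE eqxx; lia.
  have ne_lev : (M *m x) r1 0 != l' r1.
    rewrite /l' eqxx /=; have [/eqP ->|] := boolP (at_lo r1); last by [].
    by rewrite -subr_eq0 opprD addNKr.
  have sum0 := sum_eq0_of_levels _ _ _ _ _ _ _ _ Mx' My ne_lev sumc combc.
  split=> //; under eq_bigr do rewrite -x'E.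
  by rewrite -scaler_suml sum0 scale0r.
move=> y [<- //|y_in] r; have := y_in r; rewrite /l' !inE.
case: eqVneq => [->|//]; rewrite r1S /=; case: ifP => _; lia.
Qed.

(* The cells are those cut out by all hyperplanes M_r x = d with d integral:
   this one contains z / k in its relative interior. *)
Definition in_cell {m n : nat} (M : 'M[int]_(m, n)) (k : nat)
    (z x : 'cV[int]_n) : Prop :=
  forall r (d : int),
    (k%:Z * d <= (M *m z) r 0 -> d <= (M *m x) r 0) /\
    ((M *m z) r 0 <= k%:Z * d -> (M *m x) r 0 <= d).

Lemma in_cell_level {m n : nat} {M : 'M[int]_(m, n)} {k : nat}
    {z x : 'cV[int]_n} {r : 'I_m} {d : int} :
  in_cell M k z x -> (M *m z) r 0 = k%:Z * d -> (M *m x) r 0 = d.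
Proof.
move=> /(_ r d)[ge_d le_d] zE; apply/eqP.
by rewrite eq_le ge_d ?le_d ?zE.
Qed.

(** Division by [k] gives the cell: floors as lower bounds, width one exactly where the remainder is
    nonzero. No integer lies strictly between the two bounds, so every integral bound on [z / k]
    passes to the cell. *)
Lemma totally_unimodular_decomposition {R : realType} {m n : nat}
    (M : 'M[int]_(m, n)) (k : nat) (z : 'cV[int]_n) :
  totally_unimodular M ->
  (forall v : 'cV[R]_n, map_mx intr M *m v = 0 -> v = 0) -> (0 < k)%N ->
  affine_decomposition R (in_cell M k z) k z.
Proof.
move=> tuM M_inj k_gt0.
pose l r := ((M *m z) r 0%R %/ k)%Z; pose e r := ((M *m z) r 0%R %% k)%Z.
pose S := [set r | e r != 0].
have zE r : (M *m z) r 0 = k%:Z * l r + e r by rewrite mulrC -divz_eq.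
have mod_ge0 r : 0 <= e r by apply: modz_ge0; lia.
have mod_lt r : e r < k by apply: ltz_pmod; lia.
apply: affine_decomposition_sub; last first.
  apply: (cell_decomposition M k z l S) => // r; rewrite zE.
  rewrite inE; case: eqVneq (mod_ge0 r) (mod_lt r) => [-> //|_] /=; lia.
move=> x x_in r d; have := x_in r; rewrite inE zE.
case: eqVneq (mod_ge0 r) (mod_lt r) => [->|mod_neq0] /= ge0 lt_k x_r; split; nia.
Qed.

(** * Splitting an integral vector between two cells *)

(** For positive [k], this places [z / k] in the cell of [y / k], with denominators cleared. *)
Definition rounds_multiples {R : realType} {m n : nat} (M : 'M[int]_(m, n))
    (k : nat) (y : 'cV[R]_n) (z : 'cV[int]_n) : Prop :=
  forall r (d : int),
    (k%:R * d%:~R <= (map_mx intr M *m y) r 0 -> k%:Z * d <= (M *m z) r 0) /\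
    ((map_mx intr M *m y) r 0 <= k%:R * d%:~R -> (M *m z) r 0 <= k%:Z * d).

Lemma rounds_multiples_level {R : realType} {m n : nat} {M : 'M[int]_(m, n)}
    {k : nat} {y : 'cV[R]_n} {z : 'cV[int]_n} {r : 'I_m} {d : int} :
  rounds_multiples M k y z -> (map_mx intr M *m y) r 0 = k%:R * d%:~R ->
  (M *m z) r 0 = k%:Z * d.
Proof.
move=> /(_ r d)[ge_d le_d] yE; apply/eqP.
by rewrite eq_le ge_d ?le_d ?yE.
Qed.

(* z1 is a vertex of k1 C1 :&: (z1 + z2 - k2 C2), for the cells C1 and C2 of
   z1 / k1 and z2 / k2. *)
Definition jointly_tight (R : realType) {m n : nat} (M : 'M[int]_(m, n))
    (k1 k2 : nat) (z1 z2 : 'cV[int]_n) : Prop :=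
  forall v : 'cV[R]_n,
    (forall r, (exists d, (M *m z1) r 0 = k1%:Z * d) \/
               (exists d, (M *m z2) r 0 = k2%:Z * d) ->
      (map_mx (intr : int -> R) M *m v) r 0 = 0) -> v = 0.

Lemma totally_unimodular_split {R : realType} {m n : nat} (M : 'M[int]_(m, n))
    (k1 k2 : nat) (w : 'cV[int]_n) (y1 y2 : 'cV[R]_n) :
  totally_unimodular M ->
  (forall v : 'cV[R]_n, map_mx intr M *m v = 0 -> v = 0) ->
  (0 < k1)%N -> (0 < k2)%N -> map_mx intr w = y1 + y2 ->
  exists z1 z2 : 'cV[int]_n,
    [/\ w = z1 + z2,
        rounds_multiples M k1 y1 z1,
        rounds_multiples M k2 y2 z2
      & jointly_tight R M k1 k2 z1 z2].
Proof.
move=> tuM M_inj k1_gt0 k2_gt0 wE.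
have [k1R k2R] : 0 < k1%:R :> R /\ 0 < k2%:R :> R by rewrite !ltr0n.
pose fl k (y : 'cV[R]_n) r := Num.floor ((map_mx (intr : int -> R) M *m y) r 0 / k%:R).
pose ce k (y : 'cV[R]_n) r := Num.ceil ((map_mx (intr : int -> R) M *m y) r 0 / k%:R).
(* As [z2] is [w - z1], both cells become interval constraints on [z1] alone, and [y1] satisfies
   them. A row tight at a vertex makes [M *m z1] a multiple of [k1] or [M *m z2] a multiple of [k2]
   there. *)
pose lo r := Order.max (k1%:Z * fl k1 y1 r) ((M *m w) r 0 - k2%:Z * ce k2 y2 r).
pose hi r := Order.min (k1%:Z * ce k1 y1 r) ((M *m w) r 0 - k2%:Z * fl k2 y2 r).
have flP (k : nat) y r : 0 < k%:R :> R ->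
    (k%:Z * fl k y r)%:~R <= (map_mx (intr : int -> R) M *m y) r 0.
  by move=> kR; rewrite intrM mulrC -ler_pdivlMr // floor_le.
have ceP (k : nat) y r : 0 < k%:R :> R ->
    (map_mx (intr : int -> R) M *m y) r 0 <= (k%:Z * ce k y r)%:~R.
  by move=> kR; rewrite intrM mulrC -ler_pdivrMr // ceil_ge.
have Mw r : ((M *m w) r 0)%:~R = (map_mx (intr : int -> R) M *m y1) r 0 +
    (map_mx (intr : int -> R) M *m y2) r 0.
  by rewrite -mulmx_intr wE mulmxDr mxE.
have [r|z1 z1_in z1_vertex] := totally_unimodular_int_vertex M lo hi y1 tuM M_inj.
  have := flP _ y1 r k1R; have := flP _ y2 r k2R.
  have := ceP _ y1 r k1R; have := ceP _ y2 r k2R.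
  rewrite /lo /hi maxEle minEle.
  by case: ifP => _; case: ifP => _; rewrite ?intrB ?Mw; lra.
have z1_bounds r : [/\ k1%:Z * fl k1 y1 r <= (M *m z1) r 0,
    (M *m z1) r 0 <= k1%:Z * ce k1 y1 r,
    k2%:Z * fl k2 y2 r <= (M *m (w - z1)) r 0
  & (M *m (w - z1)) r 0 <= k2%:Z * ce k2 y2 r].
  have := z1_in r; rewrite /lo /hi ge_max le_min => /andP[/andP[? ?] /andP[? ?]].
  have -> : (M *m (w - z1)) r 0 = (M *m w) r 0 - (M *m z1) r 0.
    by rewrite mulmxBr !mxE.
  split=> //; lia.
have ce_le (k : nat) y r d : 0 < k%:R :> R ->
    (map_mx (intr : int -> R) M *m y) r 0 <= k%:R * d%:~R -> ce k y r <= d.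
  by move=> kR; rewrite ceil_le_int ler_pdivrMr // mulrC.
have fl_ge (k : nat) y r d : 0 < k%:R :> R ->
    k%:R * d%:~R <= (map_mx (intr : int -> R) M *m y) r 0 -> d <= fl k y r.
  by move=> kR; rewrite floor_ge_int ler_pdivlMr // mulrC.
exists z1, (w - z1); split.
- by rewrite addrC subrK.
- move=> r d; have [ge_fl le_ce _ _] := z1_bounds r; split=> y_d.
    by rewrite (le_trans _ ge_fl) // ler_wpM2l // fl_ge.
  by rewrite (le_trans le_ce) // ler_wpM2l // ce_le.
- move=> r d; have [_ _ ge_fl le_ce] := z1_bounds r; split=> y_d.
    by rewrite (le_trans _ ge_fl) // ler_wpM2l // fl_ge.
  by rewrite (le_trans le_ce) // ler_wpM2l // ce_le.
move=> v v_tight; apply: z1_vertex => r r_tight; apply: v_tight.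
have E : (M *m (w - z1)) r 0 = (M *m w) r 0 - (M *m z1) r 0.
  by rewrite mulmxBr !mxE.
move: r_tight; rewrite !inE /lo /hi maxEle minEle.
case: ifP => _; case: ifP => _ /orP[] /eqP tight.
all: try by left; rewrite tight; eexists.
all: by right; rewrite E tight subKr; eexists.
Qed.

(** Row [r0] separates the two cells, so in a joint dependence the coefficients of each family sum
    to zero. The first partial combination is then killed by the rows constant on the first cell
    and, being minus the second one, by those constant on the second cell; joint tightness makes it
    zero. *)
Lemma jointly_tight_decomposition {R : realType} {m n : nat} (M : 'M[int]_(m, n))
    (k1 k2 : nat) (z1 z2 : 'cV[int]_n) (r0 : 'I_m) (d1 d2 : int) :
  totally_unimodular M ->
  (forall v : 'cV[R]_n, map_mx intr M *m v = 0 -> v = 0) ->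
  (0 < k1)%N -> (0 < k2)%N -> jointly_tight R M k1 k2 z1 z2 ->
  (M *m z1) r0 0 = k1%:Z * d1 -> (M *m z2) r0 0 = k2%:Z * d2 -> d1 != d2 ->
  affine_decomposition R (fun x => in_cell M k1 z1 x \/ in_cell M k2 z2 x)
    (k1 + k2) (z1 + z2).
Proof.
move=> tuM M_inj k1_gt0 k2_gt0 z_tight z1_r0 z2_r0 ne_d.
apply: affine_decomposition_cat; last 2 first.
- exact: totally_unimodular_decomposition.
- exact: totally_unimodular_decomposition.
move=> s t x y l l' x_in y_in suml comb.
have Mx i := in_cell_level (x_in i) z1_r0.
have My i := in_cell_level (y_in i) z2_r0.
have sum0 := sum_eq0_of_levels _ _ _ _ _ _ _ _ Mx My ne_d suml comb.
have sum0' : \sum_i l' i = 0 by rewrite sum0 add0r in suml.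
split=> //; apply: z_tight => r [[d zE]|[d zE]].
  have Mxr i := in_cell_level (x_in i) zE.
  by rewrite (mulmx_level _ _ _ _ _ Mxr) sum0 mul0r.
have Myr i := in_cell_level (y_in i) zE.
move/eqP: comb; rewrite addr_eq0 => /eqP ->.
by rewrite mulmxN mxE (mulmx_level _ _ _ _ _ Myr) sum0' mul0r oppr0.
Qed.

(** * Splitting a point of the integer hull between two consecutive levels *)

Lemma integer_points_intr {R : realType} {n : nat} {x : 'cV[R]_n} :
  integer_points R n x -> exists z : 'cV[int]_n, x = map_mx intr z.
Proof.
move=> x_int; exists (map_mx Num.floor x); apply/matrixP => i j.
by rewrite !mxE floorK // (mxOverP x_int).
Qed.

(* Homogeneous form: x and y stand for (1 - mu) x' and mu y', which keeps the
   condition convex when one of the two sides of the split is empty. *)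
Lemma integer_hull_split {R : realType} {m n : nat} (A : 'M[int]_(m, n))
    (b : 'cV[int]_m) (a : 'cV[int]_n) (q : int) (p : 'cV[R]_n) :
  integer_hull R A b p ->
  exists (x y : 'cV[R]_n) (mu : R),
    [/\ p = x + y, 0 <= mu <= 1,
        forall i, (map_mx intr A *m x) i 0 <= (1 - mu) * (b i 0)%:~R /\
          (map_mx intr A *m y) i 0 <= mu * (b i 0)%:~R,
        (map_mx intr a^T *m x) 0 0 <= (1 - mu) * q%:~R
      & mu * (q + 1)%:~R <= (map_mx intr a^T *m y) 0 0].
Proof.
move: p; apply: smallest_sub => [p p' t|p [p_int Ap]].
  rewrite !inE.
  move=> [x [y [mu [-> mu01 Axy ax ay]]]] [x' [y' [mu' [-> mu'01 Axy' ax' ay']]]].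
  have [t0 t1] : 0 <= t%:inum /\ 0 <= 1 - t%:inum by rewrite subr_ge0.
  have mulE (d : nat) (M : 'M[R]_(d, n)) (u v : 'cV[R]_n) i :
      (M *m (t%:inum *: u + (1 - t%:inum) *: v)) i 0 =
      t%:inum * (M *m u) i 0 + (1 - t%:inum) * (M *m v) i 0.
    by rewrite mulmxDr -!scalemxAr !mxE.
  have conv_le (u u' v v' : R) : u <= u' -> v <= v' ->
      t%:inum * u + (1 - t%:inum) * v <= t%:inum * u' + (1 - t%:inum) * v'.
    by move=> le_u le_v; apply: lerD; apply: ler_wpM2l.
  exists (t%:inum *: x + (1 - t%:inum) *: x'), (t%:inum *: y + (1 - t%:inum) *: y').
  exists (t%:inum * mu + (1 - t%:inum) * mu'); split.
  - by rewrite [LHS]/conv /= !scalerDr addrACA.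
  - by nra.
  - move=> i; rewrite !mulE.
    have [Ax Ay] := Axy i; have [Ax' Ay'] := Axy' i; split.
      by apply: le_trans (conv_le _ _ _ _ Ax Ax') _; lra.
    by apply: le_trans (conv_le _ _ _ _ Ay Ay') _; lra.
  - by rewrite mulE; apply: le_trans (conv_le _ _ _ _ ax ax') _; lra.
  - by rewrite mulE; apply: le_trans (conv_le _ _ _ _ ay ay'); lra.
have [z pE] := integer_points_intr p_int.
have ap : (map_mx intr a^T *m p) 0 0 = ((a^T *m z) 0 0)%:~R by rewrite pE mulmx_intr.
have mul0 (d : nat) (M : 'M[R]_(d, n)) i : (M *m (0 : 'cV[R]_n)) i 0 = 0.
  by rewrite mulmx0 mxE.
(* The level of an integral point is an integer, so the whole point goes to one side. *)
have [le_q|lt_q] := lerP ((a^T *m z) 0 0) q.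
  exists p, 0, 0; split=> [||i||].
  - by rewrite addr0.
  - by rewrite lexx ler01.
  - by rewrite mul0 subr0 mul1r mul0r.
  - by rewrite ap subr0 mul1r ler_int.
  - by rewrite mul0 mul0r.
exists 0, p, 1; split=> [||i||].
- by rewrite add0r.
- by rewrite lexx ler01.
- by rewrite mul0 subrr mul0r mul1r.
- by rewrite mul0 subrr mul0r.
- by rewrite ap mul1r ler_int; lia.
Qed.

Lemma integer_hull_le {R : realType} {m n : nat} (A : 'M[int]_(m, n))
    (b : 'cV[int]_m) (p : 'cV[R]_n) i :
  integer_hull R A b p -> (map_mx intr A *m p) i 0 <= (b i 0)%:~R.
Proof.
move=> /(integer_hull_split A b 0 0)[x [y [mu [-> _ Axy _ _]]]].
by rewrite mulmxDr mxE; have [Ax Ay] := Axy i; lra.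
Qed.

(** Here [f] and [g] are the levels of the two sides of the split, measured from [q], and [al], [be]
    are the fractions of them that form the part on level [q]. The two equations are solved by
    Cramer's rule, with determinant [(1 - mu) * g - mu * f = D]. *)
Lemma level_weights {R : realFieldType} (mu th f g : R) :
  0 <= mu <= 1 -> 0 < th < 1 -> f <= 0 -> mu <= g -> f + g = th ->
  exists al be, [/\ 0 <= al <= 1, 0 <= be <= 1,
    al * (1 - mu) + be * mu = 1 - th & al * f + be * g = 0].
Proof.
move=> mu01 th01 f_le0 g_ge fg; pose D := g - th * mu.
have D_gt0 : 0 < D.
  have [mu_le0|mu_gt0] := lerP mu 0; first by rewrite /D; nra.
  by have := ltr_pM2r mu_gt0 th 1; rewrite /D; lra.
exists ((1 - th) * g / D), (- (1 - th) * f / D).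
have D_neq0 : g - th * mu != 0 by rewrite gt_eqF.
split.
- by rewrite divr_ge0 ?ler_pdivrMr /D; nra.
- by rewrite divr_ge0 ?ler_pdivrMr /D; nra.
- by rewrite /D -fg; rewrite -fg in D_neq0; field.
- by rewrite /D; field.
Qed.

(** The fractions [al] and [be] give [y1]. The complementary fractions automatically have mass [th]
    and level [q + th - (1 - th) * q = th * (q + 1)]. *)
Lemma integer_hull_levels {R : realType} {m n : nat} (A : 'M[int]_(m, n))
    (b : 'cV[int]_m) (a : 'cV[int]_n) (q : int) (th : R) (p : 'cV[R]_n) :
  integer_hull R A b p -> 0 < th < 1 ->
  (map_mx intr a^T *m p) 0 0 = q%:~R + th ->
  exists y1 y2 : 'cV[R]_n,
    [/\ p = y1 + y2,
        forall i, (map_mx intr A *m y1) i 0 <= (1 - th) * (b i 0)%:~R,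
        forall i, (map_mx intr A *m y2) i 0 <= th * (b i 0)%:~R,
        (map_mx intr a^T *m y1) 0 0 = (1 - th) * q%:~R
      & (map_mx intr a^T *m y2) 0 0 = th * (q + 1)%:~R].
Proof.
move=> /(integer_hull_split A b a q)[x [y [mu [-> mu01 Axy ax ay]]]] th01.
rewrite mulmxDr mxE => axy; rewrite intrD in ay.
have [|||al [be [al01 be01 mass level]]] := level_weights mu th
    ((map_mx intr a^T *m x) 0 0 - (1 - mu) * q%:~R)
    ((map_mx intr a^T *m y) 0 0 - mu * q%:~R) mu01 th01.
- by lra.
- by lra.
- by rewrite addrACA axy; ring.
have mulE (d : nat) (M : 'M[R]_(d, n)) (s t : R) i :
    (M *m (s *: x + t *: y)) i 0 = s * (M *m x) i 0 + t * (M *m y) i 0.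
  by rewrite mulmxDr -!scalemxAr !mxE.
have level1 : al * (map_mx intr a^T *m x) 0 0 + be * (map_mx intr a^T *m y) 0 0 =
    (1 - th) * q%:~R by rewrite -mass; lra.
exists (al *: x + be *: y), ((1 - al) *: x + (1 - be) *: y); split.
- by rewrite addrACA -!scalerDl !subrKC !scale1r.
- move=> i; have [Ax Ay] := Axy i; rewrite mulE -mass [leRHS]mulrDl -!mulrA.
  by apply: lerD; apply: ler_wpM2l => //; lra.
- move=> i; have [Ax Ay] := Axy i; rewrite mulE.
  have -> : th = (1 - al) * (1 - mu) + (1 - be) * mu by lra.
  by rewrite [leRHS]mulrDl -!mulrA; apply: lerD; apply: ler_wpM2l => //; lra.
- by rewrite mulE.
- by rewrite mulE intrD; lra.
Qed.

Theorem theorem8 (R : realType) (m n : nat) (Ahat : 'M[int]_(m, n))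
    (a : 'cV[int]_n) (b c : 'cV[int]_m)
    (hA : totally_unimodular Ahat)
    (ha : exists r : 'I_m, a^T = row r Ahat) :
  integer_Caratheodory_property
    (integer_hull R (Ahat + c *m a^T) b).
Proof.
move=> k w k_gt0 w_int [p p_hull pE]; have [r0 aE] := ha.
set A := Ahat + c *m a^T in p_hull *.
pose M := col_mx Ahat (1%:M : 'M[int]_n).
have tuM : totally_unimodular M by exact: totally_unimodular_col_mx1.
have M_inj (v : 'cV[R]_n) : map_mx intr M *m v = 0 -> v = 0.
  by rewrite map_col_mx map_mx1 mul_col_mx mul1mx -col_mx0 => /eq_col_mx[].
have ME (x : 'cV[int]_n) i : (M *m x) (lshift n i) 0 = (Ahat *m x) i 0.
  by rewrite mul_col_mx col_mxEu.
have MRE (x : 'cV[R]_n) i : (map_mx intr M *m x) (lshift n i) 0 =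
    (map_mx (intr : int -> R) Ahat *m x) i 0.
  by rewrite map_col_mx mul_col_mx col_mxEu.
have aTE (x : 'cV[int]_n) : (a^T *m x) 0 0 = (Ahat *m x) r0 0.
  by rewrite aE -row_mul mxE.
have aRE (x : 'cV[R]_n) : (map_mx intr a^T *m x) 0 0 =
    (map_mx (intr : int -> R) Ahat *m x) r0 0.
  by rewrite aE map_row -row_mul mxE.
have AE (x : 'cV[int]_n) i :
    (A *m x) i 0 = (Ahat *m x) i 0 + c i 0 * (Ahat *m x) r0 0.
  rewrite /A mulmxDl [LHS]mxE -mulmxA; congr (_ + _).
  by rewrite [LHS]mxE big_ord1 aTE.
have ARE (x : 'cV[R]_n) i : (map_mx intr A *m x) i 0 =
    (map_mx (intr : int -> R) Ahat *m x) i 0 +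
    (c i 0)%:~R * (map_mx (intr : int -> R) Ahat *m x) r0 0.
  rewrite /A map_mxD map_mxM mulmxDl [LHS]mxE -mulmxA; congr (_ + _).
  by rewrite [LHS]mxE big_ord1 aRE mxE.
have [z wE] := integer_points_intr w_int.
suff [t [x [d [x_ind Ax sumd zE]]]] :
    affine_decomposition R (fun x => forall i, (A *m x) i 0 <= b i 0) k z.
  exists t, (fun i => map_mx intr (x i)), d; split=> // [i|].
    have xi_int : integer_points R n (map_mx intr (x i)).
      by apply/mxOverP => j l; rewrite mxE intr_int.
    split=> //; apply: (sub_smallest (fun _ h => h)); split=> // j.
    by rewrite mulmx_intr ler_int.
  rewrite wE zE raddf_sum; apply: eq_bigr => i _ /=.
  by apply/colP => j; rewrite !mxE intrM rmorph_nat.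
pose q := ((Ahat *m z) r0 0%R %/ k)%Z.
have [k2 k2E] : exists k2 : nat, ((Ahat *m z) r0 0%R %% k)%Z = k2.
  have : 0 <= ((Ahat *m z) r0 0%R %% k)%Z by apply: modz_ge0; lia.
  by case: modz => // e _; exists e.
have k2_lt : (k2 < k)%N.
  by have := ltz_pmod ((Ahat *m z) r0 0%R) (k_gt0 : 0 < k%:Z); rewrite k2E.
have zr0 : (Ahat *m z) r0 0 = k%:Z * q + k2%:Z by rewrite -k2E mulrC -divz_eq.
(* On level [lev] of [a], row [i] of the system reads [Ahat x <= b - lev c], an integral bound on a
   row of [M], which the cell of [v / j] inherits. *)
have level_feasible (j : nat) (lev : int) (v x : 'cV[int]_n) :
    (M *m v) (lshift n r0) 0 = j%:Z * lev ->
    (forall i, (M *m v) (lshift n i) 0 <= j%:Z * (b i 0 - c i 0 * lev)) ->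
    in_cell M j v x -> forall i, (A *m x) i 0 <= b i 0.
  move=> v_r0 v_le x_in i; rewrite AE -!ME (in_cell_level x_in v_r0) -lerBrDr.
  exact/(x_in _ _).2/v_le.
(* If [k] divides the level of [z], then [p] already lies on the integral level [q] and its single
   cell suffices. *)
have [k2_0|k2_gt0] := posnP k2.
  apply: affine_decomposition_sub
    (totally_unimodular_decomposition M k z tuM M_inj k_gt0) => x.
  apply: (level_feasible k q); rewrite ?ME ?zr0 ?k2_0 ?addr0 // => i.
  have /(ler_wpM2l (ler0n R k)) := integer_hull_le _ _ p i p_hull.
  have -> : k%:R * (map_mx intr A *m p) i 0 = ((A *m z) i 0)%:~R.
    by rewrite -mulmx_intr -wE -pE -scalemxAr [RHS]mxE.
  by rewrite -[k%:R]/(k%:Z%:~R) -intrM ler_int ME AE zr0 k2_0; lia.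
(* The fractional part of the level of [p]; scaling by [k] turns the masses [1 - th] and [th] into
   the integers [k1] and [k2]. *)
pose th : R := k2%:R / k%:R; pose k1 := (k - k2)%N.
have kR_gt0 : 0 < k%:R :> R by rewrite ltr0n.
have kth : k%:R * th = k2%:R by rewrite mulrC divfK ?gt_eqF.
have k1E : k%:R * (1 - th) = k1%:R by rewrite mulrBr mulr1 kth natrB // ltnW.
have th01 : 0 < th < 1.
  by rewrite divr_gt0 ?ltr0n //= ltr_pdivrMr // mul1r ltr_nat.
have ap : (map_mx intr a^T *m p) 0 0 = q%:~R + th.
  apply: (mulfI (lt0r_neq0 kR_gt0)); rewrite mulrDr kth.
  have := mulmx_intr Ahat z r0 (R := R); rewrite -wE -pE -scalemxAr mxE -aRE => ->.
  by rewrite zr0 intrD intrM.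
have [y1 [y2 [py Ay1 Ay2 ay1 ay2]]] := integer_hull_levels A b a q th p p_hull th01 ap.
have k1_gt0 : (0 < k1)%N by rewrite subn_gt0.
have zy : map_mx intr z = k%:R *: y1 + k%:R *: y2.
  by rewrite -wE -pE py scalerDr.
have [z1 [z2 [zE z1_rounds z2_rounds z_tight]]] :=
  totally_unimodular_split M k1 k2 z _ _ tuM M_inj k1_gt0 k2_gt0 zy.
have scaleE (y : 'cV[R]_n) i : (map_mx (intr : int -> R) M *m (k%:R *: y)) i 0 =
    k%:R * (map_mx (intr : int -> R) M *m y) i 0.
  by rewrite -scalemxAr mxE.
(* Rounding preserves both the level and the constraints, since on that level all of them are
   integral bounds on rows of [M]. *)
have level_bound (y : 'cV[R]_n) (s : R) (j : nat) (lev : int) v :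
    k%:R * s = j%:R -> (map_mx intr a^T *m y) 0 0 = s * lev%:~R ->
    (forall i, (map_mx intr A *m y) i 0 <= s * (b i 0)%:~R) ->
    rounds_multiples M j (k%:R *: y) v ->
    (M *m v) (lshift n r0) 0 = j%:Z * lev /\
    forall i, (M *m v) (lshift n i) 0 <= j%:Z * (b i 0 - c i 0 * lev).
  move=> sE; rewrite aRE => ay Ay v_rounds; split=> [|i].
    by apply: (rounds_multiples_level v_rounds); rewrite scaleE MRE ay mulrA sE.
  apply: (v_rounds _ _).2; rewrite scaleE MRE -sE -mulrA ler_pM2l // intrB intrM.
  by have := Ay i; rewrite ARE ay; lra.
have [z1_r0 z1_le] := level_bound _ _ _ _ _ k1E ay1 Ay1 z1_rounds.
have [z2_r0 z2_le] := level_bound _ _ _ _ _ kth ay2 Ay2 z2_rounds.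
have -> : k = (k1 + k2)%N by rewrite subnK // ltnW.
have ne_q : q != q + 1 by lia.
rewrite zE; apply: affine_decomposition_sub
  (jointly_tight_decomposition M k1 k2 z1 z2 _ _ _ tuM M_inj k1_gt0 k2_gt0
     z_tight z1_r0 z2_r0 ne_q) => x [x_in|x_in].
  exact: level_feasible z1_r0 z1_le x_in.
exact: level_feasible z2_r0 z2_le x_in.
Qed.
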